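(* Let $F$ be a field and let $\Gamma$ be a connected weighted graph over $F$ with four vertices and without null vertices. Then $\Gamma$ does not admit a consistent labeling if and only if it is defective.
   Context: Weighted graphs: a weighted graph over $F$ is a finite simple graph $\Gamma=(V,E)$ with ordered vertex set $V=\{v_1,\dots,v_n\}$, where each edge $e_{i,j}$ ($i<j$) joining $v_i$ and $v_j$ carries a weight $d_{i,j}\in F$ (possibly $0$). A vertex is a null vertex if every edge incident to it has weight $0$. A consistent labeling of $\Gamma$ is an assignment $v_k\mapsto(a_k,b_k)\in F\times F$ for all $k$ such that $a_ib_j-a_jb_i=d_{i,j}$ for every edge $e_{i,j}\in E$, $i<j$. For an edge between $v_i$ and $v_j$ with $i<j$ put $d(v_i,v_j):=d_{i,j}$ and $d(v_j,v_i):=-d_{i,j}$. Defects: - type $(4)_A$: there are distinct vertices $p_1,p_2,p_3,p_4$ such that $p_1p_2,p_1p_3,p_2p_3,p_3p_4$ are edges, $d(p_1,p_3)=d(p_2,p_3)=0$, $d(p_1,p_2)\neq0$ and $d(p_3,p_4)\ne 0$. - type $(4)_B$: there are distinct vertices $p_1,p_2,p_3,p_4$ such that $p_1p_2,p_1p_3,p_1p_4,p_2p_3,p_3p_4$ are edges, $d(p_1,p_3)=0$, the weights $d(p_1,p_2),d(p_1,p_4),d(p_2,p_3),d(p_3,p_4)$ are all nonzero, and $d(p_1,p_2)d(p_3,p_4)\neq -d(p_1,p_4)d(p_2,p_3)$. - type $(4)_C$: there are distinct vertices $p_1,p_2,p_3,p_4$, all six pairs of which are edges with nonzero weights, and $d(p_1,p_2)d(p_3,p_4)+d(p_1,p_4)d(p_2,p_3)\neq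 d(p_1,p_3)d(p_2,p_4)$. Other edges of $\Gamma$ may be present in addition to the listed ones. A weighted graph with four vertices is defective if it has a defect of type $(4)_A$, $(4)_B$ or $(4)_C$. *)

(* Defs.v *)
From mathcomp Require Import all_boot all_order all_algebra.
Set Implicit Arguments.
Unset Strict Implicit.
Unset Printing Implicit Defensive.
Import GRing.Theory.
Local Open Scope ring_scope.

(* The vertex v_(k+1) is k : 'I_n.  Only the values [weight G i j] with
   [edge G i j] and i < j are meaningful: they are the weights d_{i,j}.  No
   definition below depends on the others. *)
Record weighted_graph (F : fieldType) (n : nat) := WeightedGraph {
  edge : rel 'I_n;
  edge_sym : symmetric edge;
  edge_irr : irreflexive edge;
  weight : 'I_n -> 'I_n -> F
}.

Definition connected_graph (F : fieldType) (n : nat)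
    (G : weighted_graph F n) : Prop :=
  forall u v : 'I_n, connect (edge G) u v.

Definition null_vertex (F : fieldType) (n : nat) (G : weighted_graph F n)
    (v : 'I_n) : Prop :=
  forall i j : 'I_n, (i < j)%N -> edge G i j -> (v == i) || (v == j) ->
    weight G i j = 0.

Definition consistent_labeling (F : fieldType) (n : nat)
    (G : weighted_graph F n) (l : 'I_n -> F * F) : Prop :=
  forall i j : 'I_n, (i < j)%N -> edge G i j ->
    (l i).1 * (l j).2 - (l j).1 * (l i).2 = weight G i j.

(* The signed weight d(u, v); used only when u and v are adjacent. *)
Definition dwt (F : fieldType) (n : nat) (G : weighted_graph F n)
    (u v : 'I_n) : F :=
  if (u < v)%N then weight G u v else - weight G v u.

Definition defect4A (F : fieldType) (n : nat) (G : weighted_graph F n) : Prop :=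
  exists p1 p2 p3 p4 : 'I_n,
    [/\ uniq [:: p1; p2; p3; p4],
        [&& edge G p1 p2, edge G p1 p3, edge G p2 p3 & edge G p3 p4],
        dwt G p1 p3 = 0 /\ dwt G p2 p3 = 0,
        dwt G p1 p2 != 0
      & dwt G p3 p4 != 0].

Definition defect4B (F : fieldType) (n : nat) (G : weighted_graph F n) : Prop :=
  exists p1 p2 p3 p4 : 'I_n,
    [/\ uniq [:: p1; p2; p3; p4],
        [&& edge G p1 p2, edge G p1 p3, edge G p1 p4, edge G p2 p3
          & edge G p3 p4],
        dwt G p1 p3 = 0,
        [&& dwt G p1 p2 != 0, dwt G p1 p4 != 0, dwt G p2 p3 != 0
          & dwt G p3 p4 != 0]
      & dwt G p1 p2 * dwt G p3 p4 != - (dwt G p1 p4 * dwt G p2 p3)].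

Definition defect4C (F : fieldType) (n : nat) (G : weighted_graph F n) : Prop :=
  exists p1 p2 p3 p4 : 'I_n,
    [/\ uniq [:: p1; p2; p3; p4],
        [&& edge G p1 p2, edge G p1 p3, edge G p1 p4, edge G p2 p3,
            edge G p2 p4 & edge G p3 p4],
        [&& dwt G p1 p2 != 0, dwt G p1 p3 != 0, dwt G p1 p4 != 0,
            dwt G p2 p3 != 0, dwt G p2 p4 != 0 & dwt G p3 p4 != 0]
      & dwt G p1 p2 * dwt G p3 p4 + dwt G p1 p4 * dwt G p2 p3
          != dwt G p1 p3 * dwt G p2 p4].

Definition defective (F : fieldType) (G : weighted_graph F 4) : Prop :=
  [\/ defect4A G, defect4B G | defect4C G].

(* Main.v *)
Require Import Defs.
From mathcomp Require Import all_boot all_order all_algebra.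
From mathcomp Require Import ring.
Set Implicit Arguments.
Unset Strict Implicit.
Unset Printing Implicit Defensive.
Import GRing.Theory.
Local Open Scope ring_scope.

(* The six 2x2 minors of four vectors of F^2 satisfy the Pluecker relation
   d12 d34 - d13 d24 + d14 d23 = 0, and each defect contradicts it.  Conversely,
   fix a pair p3 p4 with a nonzero value c, where c is free if p3 p4 is not an
   edge.  The labels p3 = (1, 0) and p4 = (0, c) determine those of p1 and p2,
   and the only remaining condition is the Pluecker relation, required only if
   p1 p2 is an edge.  Hence, without a labeling, the pair opposite to a non-edge
   is an edge of weight 0, and the weights, extended by 0 to the non-edges,
   violate the Pluecker relation.  If its three terms are nonzero, this is a
   defect (4)_C; if exactly one vanishes, a defect (4)_B; if two vanish, two
   edges of weight 0 from different terms share a vertex, which is a defect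
   (4)_A. *)

Definition cross (F : fieldType) (u v : F * F) : F := u.1 * v.2 - v.1 * u.2.

Definition pluecker (F : fieldType) (T : Type) (D : T -> T -> F)
    (p1 p2 p3 p4 : T) : F :=
  D p1 p2 * D p3 p4 - D p1 p3 * D p2 p4 + D p1 p4 * D p2 p3.

(** The extension by 0 is antisymmetric on all pairs, so the Pluecker expression in it changes only
    by signs when the points are permuted. *)
Definition ewt (F : fieldType) (n : nat) (G : weighted_graph F n)
    (u v : 'I_n) : F :=
  if edge G u v then dwt G u v else 0.

Lemma pluecker_cross (F : fieldType) (T : Type) (l : T -> F * F)
    (p1 p2 p3 p4 : T) :
  pluecker (fun u v => cross (l u) (l v)) p1 p2 p3 p4 = 0.
Proof. rewrite /pluecker /cross; ring. Qed.

Ltac uniq_perm U :=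
  move: U; rewrite /= !inE !negb_or !andbT;
  case/and3P=> /and3P[? ? ?] /andP[? ?] ?;
  repeat (apply/andP; split); rewrite // eq_sym.

(** By counting: a duplicate-free list as long as the enumeration of ['I_4] exhausts it. *)
Lemma mem_uniq4 (p1 p2 p3 p4 v : 'I_4) :
  uniq [:: p1; p2; p3; p4] -> v \in [:: p1; p2; p3; p4].
Proof.
move=> Up.
have sub : {subset [:: p1; p2; p3; p4] <= enum 'I_4}.
  by move=> x _; rewrite mem_enum.
have [|_ ->] := uniq_min_size Up sub; first by rewrite size_enum_ord.
by rewrite mem_enum.
Qed.

Lemma uniq4_extend (u v : 'I_4) :
  u != v -> exists w x : 'I_4, uniq [:: w; x; u; v].
Proof.
move=> uv.
have : #|~: [set u; v]| == 2%N by rewrite cardsCs setCK cards2 uv card_ord.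
case/cards2P=> w [x [wx E]]; exists w, x.
have : w \in ~: [set u; v] by rewrite E !inE eqxx.
have : x \in ~: [set u; v] by rewrite E !inE eqxx orbT.
rewrite !inE !negb_or => /andP[xu xv] /andP[wu wv].
by rewrite /= !inE !negb_or wx wu wv xu xv uv.
Qed.

(** * Signed weights and consistent labelings *)

Section WeightedGraph.

Variables (F : fieldType) (n : nat) (G : weighted_graph F n).
Implicit Types u v : 'I_n.

Lemma edge_neq u v : edge G u v -> u != v.
Proof. by apply: contraTneq => ->; rewrite edge_irr. Qed.

Lemma dwtC u v : u != v -> dwt G u v = - dwt G v u.
Proof.
by rewrite /dwt => uv; case: ltngtP => [||/val_inj E]; rewrite ?opprK // E eqxx in uv *.
Qed.

Lemma ewtC u v : ewt G u v = - ewt G v u.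
Proof.
rewrite /ewt edge_sym; case: ifP => [/edge_neq|]; last by rewrite oppr0.
by rewrite eq_sym; apply: dwtC.
Qed.

Lemma ewtE u v : edge G u v -> ewt G u v = dwt G u v.
Proof. by rewrite /ewt => ->. Qed.

Lemma ewt_edge u v : ewt G u v != 0 -> edge G u v.
Proof. by rewrite /ewt; case: ifP => //; rewrite eqxx. Qed.

Lemma ewt_nonedge u v : ~~ edge G u v -> ewt G u v = 0.
Proof. by rewrite /ewt => /negbTE ->. Qed.

Lemma consistent_labelingP (l : 'I_n -> F * F) :
  consistent_labeling G l <->
  (forall u v, edge G u v -> cross (l u) (l v) = ewt G u v).
Proof.
split=> H u v; last by move=> uv e; rewrite -/(cross _ _) H // ewtE // /dwt uv.
move=> e; rewrite ewtE // /dwt; case: (ltngtP u v) => [uv|vu|/val_inj E].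
- exact: H.
- by rewrite -H 1?edge_sym // /cross opprB.
- by rewrite E edge_irr in e.
Qed.

End WeightedGraph.

(** * Labelings of graphs with four vertices *)

Section FourVertices.

Variables (F : fieldType) (G : weighted_graph F 4).
Implicit Types p : 'I_4.
Notation D := (ewt G).

Lemma labeling_of_pivot (c : F) p1 p2 p3 p4 :
    uniq [:: p1; p2; p3; p4] -> c != 0 ->
    (edge G p3 p4 -> D p3 p4 = c) ->
    (edge G p1 p2 -> D p1 p2 * c - D p1 p3 * D p2 p4 + D p1 p4 * D p2 p3 = 0) ->
  exists l : 'I_4 -> F * F, consistent_labeling G l.
Proof.
move=> Up c0 H34 H12.
(* The last case solves [cross (l p) (1, 0) = D p p3] and [cross (l p) (0, c) = D p p4] for
   [l p]. *)
pose l p := if p == p3 then (1, 0) else if p == p4 then (0, c)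
            else (D p p4 / c, - D p p3).
exists l; apply/consistent_labelingP.
have M := mem_uniq4 _ Up.
have l3 : l p3 = (1, 0) by rewrite /l eqxx.
move: Up; rewrite /= !inE !negb_or !andbT.
case/and3P=> /and3P[_ n13 n14] /andP[n23 n24] n34.
have l4 : l p4 = (0, c) by rewrite /l eq_sym (negbTE n34) eqxx.
have l1 : l p1 = (D p1 p4 / c, - D p1 p3).
  by rewrite /l (negbTE n13) (negbTE n14).
have l2 : l p2 = (D p2 p4 / c, - D p2 p3).
  by rewrite /l (negbTE n23) (negbTE n24).
have E12 : edge G p1 p2 -> cross (l p1) (l p2) = D p1 p2.
  (* Multiplication by [c] turns the claim into the relation [H12]. *)
  move=> e; apply: (mulIf c0).
  have -> : D p1 p2 * c = D p1 p3 * D p2 p4 - D p1 p4 * D p2 p3.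
    by apply/eqP; rewrite -subr_eq0 -(H12 e); apply/eqP; ring.
  by rewrite l1 l2 /cross /=; field.
have E13 : cross (l p1) (l p3) = D p1 p3 by rewrite l1 l3 /cross /=; ring.
have E14 : cross (l p1) (l p4) = D p1 p4 by rewrite l1 l4 /cross /=; field.
have E23 : cross (l p2) (l p3) = D p2 p3 by rewrite l2 l3 /cross /=; ring.
have E24 : cross (l p2) (l p4) = D p2 p4 by rewrite l2 l4 /cross /=; field.
have E34 : edge G p3 p4 -> cross (l p3) (l p4) = D p3 p4.
  by move=> /H34->; rewrite l3 l4 /cross /=; ring.
have S u v : cross (l u) (l v) = D u v -> cross (l v) (l u) = D v u.
  by move=> E; rewrite ewtC -E /cross opprB.
move=> u v; move: (M u) (M v); rewrite !inE.
by do 2![case/or4P => /eqP ->]; rewrite ?edge_irr // => e;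
  auto; apply: S; rewrite edge_sym in e; auto.
Qed.

(** * Defects forced by edges of weight 0 *)

Section ZeroEdges.

(* Not automatic, since [D] also vanishes on non-edges: it expresses the absence
   of a labeling. *)
Hypothesis zero_term : forall p1 p2 p3 p4, uniq [:: p1; p2; p3; p4] ->
  D p1 p2 * D p3 p4 = 0 ->
  edge G p1 p2 /\ D p1 p2 = 0 \/ edge G p3 p4 /\ D p3 p4 = 0.

Lemma defect4A_adjacent p1 p2 p3 p4 :
    uniq [:: p1; p2; p3; p4] -> edge G p1 p3 -> D p1 p3 = 0 ->
    edge G p2 p3 -> D p2 p3 = 0 -> D p1 p2 != 0 -> D p3 p4 != 0 -> defective G.
Proof.
move=> Up e13 D13 e23 D23 D12 D34; constructor 1; exists p1, p2, p3, p4.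
have e12 := ewt_edge D12; have e34 := ewt_edge D34.
by split; rewrite ?e12 ?e13 ?e23 ?e34 -?ewtE.
Qed.

(** By [zero_term], [p1 p2] or [p3 p4] is a second zero edge; it meets [p1 p3] in [p1] or [p3]. One
    factor of the nonzero term joins the other ends of the two zero edges, and the other factor
    joins their common vertex to the fourth vertex. *)
Lemma defective_two_zero_terms p1 p2 p3 p4 :
    uniq [:: p1; p2; p3; p4] -> edge G p1 p3 -> D p1 p3 = 0 ->
    D p1 p2 * D p3 p4 = 0 -> D p1 p4 * D p2 p3 != 0 -> defective G.
Proof.
move=> Up e13 D13 T1; rewrite mulf_eq0 negb_or => /andP[D14 D23].
case: (zero_term Up T1) => -[e z].
- apply: (@defect4A_adjacent p2 p3 p1 p4); rewrite // 1?edge_sym //.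
  + by uniq_perm Up.
  + by rewrite ewtC z oppr0.
  + by rewrite ewtC D13 oppr0.
- apply: (@defect4A_adjacent p1 p4 p3 p2); rewrite // 1?edge_sym //.
  + by uniq_perm Up.
  + by rewrite ewtC z oppr0.
  + by rewrite ewtC oppr_eq0.
Qed.

Lemma defective_zero_edge p1 p2 p3 p4 :
    uniq [:: p1; p2; p3; p4] -> edge G p1 p3 -> D p1 p3 = 0 ->
    pluecker D p1 p2 p3 p4 != 0 -> defective G.
Proof.
move=> Up e13 D13; rewrite /pluecker D13 mul0r subr0 => nz.
have [T1|T1] := eqVneq (D p1 p2 * D p3 p4) 0.
  by rewrite T1 add0r in nz; apply: (defective_two_zero_terms Up).
have [T3|T3] := eqVneq (D p1 p4 * D p2 p3) 0.
  (* Exchanging [p2] and [p4] swaps the two remaining terms up to sign. *)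
  apply: (@defective_two_zero_terms p1 p4 p3 p2) => //.
  - by uniq_perm Up.
  - by rewrite [D p3 p2]ewtC mulrN T3 oppr0.
  - by rewrite [D p4 p3]ewtC mulrN oppr_eq0.
move: T1 T3; rewrite !mulf_eq0 !negb_or => /andP[D12 D34] /andP[D14 D23].
have [e12 e34 e14 e23] := And4 (ewt_edge D12) (ewt_edge D34) (ewt_edge D14)
  (ewt_edge D23).
constructor 2; exists p1, p2, p3, p4.
by rewrite -!ewtE // e12 e13 e14 e23 e34 D12 D14 D23 D34 -addr_eq0.
Qed.

Lemma defective_of_pluecker p1 p2 p3 p4 :
  uniq [:: p1; p2; p3; p4] -> pluecker D p1 p2 p3 p4 != 0 -> defective G.
Proof.
move=> Up nz.
(* A zero edge in any term can be moved to the position [q1 q3] by a permutation, which changes the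
   Pluecker expression at most by a sign. *)
have zero_edge q1 q2 q3 q4 : uniq [:: q1; q2; q3; q4] ->
    edge G q1 q3 /\ D q1 q3 = 0 ->
    (pluecker D q1 q2 q3 q4 = pluecker D p1 p2 p3 p4 \/
     pluecker D q1 q2 q3 q4 = - pluecker D p1 p2 p3 p4) -> defective G.
  move=> Uq [e z] E; apply: (defective_zero_edge Uq e z).
  by case: E => ->; rewrite ?oppr_eq0.
have [E12 E13 E14] := And3 (ewtC G p2 p1) (ewtC G p3 p1) (ewtC G p4 p1).
have [E23 E24 E34] := And3 (ewtC G p3 p2) (ewtC G p4 p2) (ewtC G p4 p3).
have [T1|T1] := eqVneq (D p1 p2 * D p3 p4) 0.
  case: (zero_term Up T1) => [H|H].
  - apply: (@zero_edge p1 p3 p2 p4) => //; first by uniq_perm Up.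
    by right; rewrite /pluecker E23; ring.
  - apply: (@zero_edge p3 p1 p4 p2) => //; first by uniq_perm Up.
    by right; rewrite /pluecker E13 E23 E24; ring.
have [T2|T2] := eqVneq (D p1 p3 * D p2 p4) 0.
  have U2 : uniq [:: p1; p3; p2; p4] by uniq_perm Up.
  case: (zero_term U2 T2) => [H|H].
  - by apply: (@zero_edge p1 p2 p3 p4) => //; left.
  - apply: (@zero_edge p2 p1 p4 p3) => //; first by uniq_perm Up.
    by left; rewrite /pluecker E12 E34; ring.
have [T3|T3] := eqVneq (D p1 p4 * D p2 p3) 0.
  have U3 : uniq [:: p1; p4; p2; p3] by uniq_perm Up.
  case: (zero_term U3 T3) => [H|H].
  - apply: (@zero_edge p1 p2 p4 p3) => //; first by uniq_perm Up.
    by right; rewrite /pluecker E34; ring.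
  - apply: (@zero_edge p2 p1 p3 p4) => //; first by uniq_perm Up.
    by right; rewrite /pluecker E12; ring.
move: T1 T2 T3; rewrite !mulf_eq0 !negb_or.
move=> /andP[D12 D34] /andP[D13 D24] /andP[D14 D23].
have [e12 e34 e14] := And3 (ewt_edge D12) (ewt_edge D34) (ewt_edge D14).
have [e13 e24 e23] := And3 (ewt_edge D13) (ewt_edge D24) (ewt_edge D23).
constructor 3; exists p1, p2, p3, p4.
rewrite -!ewtE // e12 e13 e14 e23 e24 e34 D12 D13 D14 D23 D24 D34 -subr_eq0.
by split=> //; rewrite addrAC.
Qed.

End ZeroEdges.

(** The Pluecker relation for the labels also involves pairs that may be non-edges, but in each
    defect such a pair is multiplied by a weight 0. *)
Lemma labeling_not_defective (l : 'I_4 -> F * F) :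
  consistent_labeling G l -> ~ defective G.
Proof.
move=> /consistent_labelingP Hl.
have d u v : edge G u v -> dwt G u v = cross (l u) (l v).
  by move=> e; rewrite Hl // ewtE.
have P p1 p2 p3 p4 := pluecker_cross l p1 p2 p3 p4.
case=> -[p1 [p2 [p3 [p4 []]]]] _; move: (P p1 p2 p3 p4); rewrite /pluecker.
- move=> E /and4P[e12 e13 e23 e34] [] /[!d] // z13 z23 n12.
  (* The two zero weights leave only the first term of the relation, and its factor at [p1 p2]
     cancels. *)
  apply/negP; rewrite negbK; apply/eqP; apply: (mulfI n12); rewrite mulr0.
  by rewrite -[RHS]E z13 z23; ring.
- move=> E /and5P[e12 e13 e14 e23 e34] /[!d] // z13 _; apply/negP; rewrite negbK.
  by rewrite -addr_eq0 -[X in _ == X]E z13 mul0r subr0.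
- move=> E /andP[e12 /and5P[e13 e14 e23 e24 e34]] /[!d] // _; apply/negP; rewrite negbK.
  by rewrite -subr_eq0 -[X in _ == X]E addrAC.
Qed.

(** Otherwise [p3 p4] could serve as the pivot, with [c = 1] if it is a non-edge; the condition on
    [p1 p2] is vacuous. *)
Lemma no_labeling_zero_opposite p1 p2 p3 p4 :
    ~ (exists l : 'I_4 -> F * F, consistent_labeling G l) ->
    uniq [:: p1; p2; p3; p4] -> ~~ edge G p1 p2 ->
  edge G p3 p4 /\ D p3 p4 = 0.
Proof.
move=> nol Up ne12; have ne (P : Prop) : edge G p1 p2 -> P by rewrite (negbTE ne12).
case e34 : (edge G p3 p4); last first.
  case: nol; apply: (labeling_of_pivot Up (oner_neq0 F)); last exact: ne.
  by rewrite e34.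
split=> //; apply/eqP/negPn/negP => D34; case: nol.
by apply: (labeling_of_pivot Up D34) => //; apply: ne.
Qed.

Lemma no_labeling_defective :
  ~ (exists l : 'I_4 -> F * F, consistent_labeling G l) -> defective G.
Proof.
move=> nol.
have zero_term p1 p2 p3 p4 : uniq [:: p1; p2; p3; p4] ->
    D p1 p2 * D p3 p4 = 0 ->
    edge G p1 p2 /\ D p1 p2 = 0 \/ edge G p3 p4 /\ D p3 p4 = 0.
  (* Opposite a non-edge lies a zero edge; if both pairs are edges, one factor of the product
     vanishes. *)
  move=> Up z; have [e12|e12] := boolP (edge G p1 p2); last first.
    by right; apply: (no_labeling_zero_opposite nol Up).
  have [e34|e34] := boolP (edge G p3 p4); last first.
    have U' : uniq [:: p3; p4; p1; p2] by uniq_perm Up.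
    by case: (no_labeling_zero_opposite nol U' e34); left.
  by move/eqP: z; rewrite mulf_eq0 => /orP[/eqP|/eqP]; [left|right].
case: (pickP (fun p : 'I_4 * 'I_4 => D p.1 p.2 != 0)) => [[u v] /= Duv | D0].
  have [w [x U]] := uniq4_extend (edge_neq (ewt_edge Duv)).
  apply: (defective_of_pluecker zero_term U); apply/eqP => E.
  by case: nol; apply: (labeling_of_pivot U Duv).
(* There is no pivot edge: all weights are 0, and zero labels are consistent. *)
case: nol; exists (fun=> 0); apply/consistent_labelingP => u v _.
by move/eqP: (negbFE (D0 (u, v))) => /= ->; rewrite /cross /= mul0r subr0.
Qed.

End FourVertices.

Theorem theorem3p1 (F : fieldType) (G : weighted_graph F 4)
    (Gconn : connected_graph G)
    (Gnonull : forall v : 'I_4, ~ null_vertex G v) :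
  ~ (exists l : 'I_4 -> F * F, consistent_labeling G l) <-> defective G.
Proof.
split; first exact: no_labeling_defective.
by move=> defG [l Hl]; apply: (labeling_not_defective Hl).
Qed.
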